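(* Let $G$ be a finite group and let $\mathcal{G}(G)$ denote its power graph. Then $\kappa'(\mathcal{G}(G))=\delta(\mathcal{G}(G))$.
   Context: The power graph $\mathcal{G}(G)$ of a group $G$ is the simple undirected graph with vertex set $G$ in which distinct $u,v$ are adjacent iff $v=u^{\alpha}$ for some $\alpha\in\mathbb{N}$ or $u=v^{\beta}$ for some $\beta\in\mathbb{N}$. For a graph $\Gamma$, $\delta(\Gamma)$ is its minimum degree and $\kappa'(\Gamma)$ its edge-connectivity: the minimum number of edges whose removal results in a disconnected or trivial (one-vertex) graph (so it is $0$ for disconnected or trivial graphs). *)

(* Defs.v *)
From HB Require Import structures.
From mathcomp Require Import all_boot all_fingroup.
From mathcomp Require Import boolp.

Set Implicit Arguments.
Unset Strict Implicit.
Unset Printing Implicit Defensive.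

Record sgraph := SGraph {
  vertex :> finType;
  adj : rel vertex;
  adj_sym : symmetric adj;
  adj_irrefl : irreflexive adj
}.

Definition degree (Gamma : sgraph) (v : Gamma) : nat := #|[set w | adj v w]|.

(* Every degree is smaller than #|Gamma|, so for a nonempty graph the default
   value of the iterated minimum is never returned. *)
Definition min_degree (Gamma : sgraph) : nat :=
  \big[minn/#|Gamma|]_(v : Gamma) degree v.

Definition edges (Gamma : sgraph) : {set {set Gamma}} :=
  [set [set p.1; p.2] | p : Gamma * Gamma & adj p.1 p.2].

Definition del_adj (Gamma : sgraph) (F : {set {set Gamma}}) : rel Gamma :=
  fun x y => adj x y && ([set x; y] \notin F).

Lemma del_adj_sym (Gamma : sgraph) (F : {set {set Gamma}}) :
  symmetric (del_adj F).
Proof. by move=> x y; rewrite /del_adj adj_sym setUC. Qed.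

Lemma del_adj_irrefl (Gamma : sgraph) (F : {set {set Gamma}}) :
  irreflexive (del_adj F).
Proof. by move=> x; rewrite /del_adj adj_irrefl. Qed.

Definition del_edges (Gamma : sgraph) (F : {set {set Gamma}}) : sgraph :=
  SGraph (del_adj_sym F) (del_adj_irrefl F).

Definition connected (Gamma : sgraph) : bool :=
  [forall x : Gamma, forall y : Gamma, connect (@adj Gamma) x y].

Definition disconnected_or_trivial (Gamma : sgraph) : bool :=
  ~~ connected Gamma || (#|Gamma| == 1).

(* For a nonempty graph, F := edges Gamma is admissible, so the default value
   #|edges Gamma| is itself one of the competing values. *)
Definition edge_connectivity (Gamma : sgraph) : nat :=
  \big[minn/#|edges Gamma|]_(F in powerset (edges Gamma)
                              | disconnected_or_trivial (del_edges F)) #|F|.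

(* Allowing the exponent 0 is harmless: u ^+ 0 = u ^+ #[u] in a finite group. *)
Definition power_adj (gT : finGroupType) : rel gT := fun u v =>
  `[< u <> v /\
      ((exists a : nat, v = (u ^+ a)%g) \/ (exists b : nat, u = (v ^+ b)%g)) >].

Lemma power_adj_sym (gT : finGroupType) : symmetric (@power_adj gT).
Proof.
move=> u v; apply/asboolP/asboolP => -[uv H]; split; first exact: nesym.
- by case: H => H; [right | left].
- exact: nesym.
- by case: H => H; [right | left].
Qed.

Lemma power_adj_irrefl (gT : finGroupType) : irreflexive (@power_adj gT).
Proof. by move=> u; apply/asboolP => -[]. Qed.

Definition power_graph (gT : finGroupType) : sgraph :=
  SGraph (@power_adj_sym gT) (@power_adj_irrefl gT).

(* Main.v *)
Require Import Defs.
From HB Require Import structures.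
From mathcomp Require Import all_boot all_fingroup.
From mathcomp Require Import boolp.

(** The identity is adjacent to every other vertex of the power graph, and
    edge-connectivity equals minimum degree in any graph with such a universal
    vertex [u].  If deleting [F] separates some [s] from [u], let [S] be the
    component of [s].  Send a neighbour [w] of [s] to the edge [{s, w}] if [w]
    is outside [S], and to [{u, w}] if [w] is in [S].  These edges leave [S], so
    they lie in [F], and they are pairwise distinct; hence [deg s <= #|F|]. *)

(** The default [d] takes part in the iterated minimum even when [P] is inhabited, hence the
    conjunct [m <= d]. *)
Lemma bigminn_geP (I : finType) (P : pred I) (f : I -> nat) (d m : nat) :
  reflect (m <= d /\ forall i, P i -> m <= f i)
          (m <= \big[minn/d]_(i | P i) f i).
Proof.
apply: (iffP idP) => [|[md mf]]; last first.
  by apply: (big_ind (leq m)) => // x y mx my; rewrite leq_min mx.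
have -> : (m <= \big[minn/d]_(i | P i) f i)
        = (m <= d) && all (fun i => P i ==> (m <= f i)) (index_enum I).
  elim: (index_enum I) => [|i s IHs]; first by rewrite big_nil andbT.
  rewrite big_cons /=; case: (P i) => //=.
  by rewrite leq_min IHs andbCA.
case/andP=> md /allP mf; split=> // i Pi.
by have := mf i (mem_index_enum i); rewrite Pi.
Qed.

Section Degree.

Variable Gamma : sgraph.

Lemma min_degree_le (v : Gamma) : min_degree Gamma <= degree v.
Proof.
by have /bigminn_geP[_] := leqnn (min_degree Gamma); apply.
Qed.

Definition star (v : Gamma) : {set {set Gamma}} :=
  [set [set v; w] | w in [set w | adj v w]].

Lemma star_sub_edges (v : Gamma) : star v \subset edges Gamma.
Proof.
apply/subsetP => _ /imsetP[w vw ->]; rewrite inE in vw.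
by apply/imsetP; exists (v, w) => //; rewrite inE.
Qed.

Lemma card_star (v : Gamma) : #|star v| = degree v.
Proof.
apply: card_in_imset => w w'; rewrite !inE => vw vw' E.
have : w \in [set v; w'] by rewrite -E set22.
by rewrite !inE => /orP[] /eqP // Ew; rewrite Ew adj_irrefl in vw.
Qed.

(** If some [w] differs from [v], a path from [v] to [w] would start with an edge of [star v], all
    of which are deleted; otherwise [v] is the only vertex. *)
Lemma isolating_cut (v : Gamma) : disconnected_or_trivial (del_edges (star v)).
Proof.
rewrite /disconnected_or_trivial orbC -implyNb; apply/implyP => Gamma_neq1.
have [w nwv] : exists w : Gamma, w != v.
  apply/existsP; apply: contraNT Gamma_neq1; rewrite negb_exists => /forallP Ev.
  rewrite eqn_leq; apply/andP; split; last by apply/card_gt0P; exists v.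
  apply/fintype_le1P => x y; move: (Ev x) (Ev y).
  by rewrite !negbK => /eqP-> /eqP->.
apply/negP => /forallP/(_ v)/forallP/(_ w)/connectP[[|x p] /=].
  by move=> _ E; rewrite E eqxx in nwv.
by case/andP=> /andP[vx /negP nstar] _ _; case: nstar; apply/imsetP; exists x; rewrite ?inE.
Qed.

Lemma edge_connectivity_le_degree (v : Gamma) : edge_connectivity Gamma <= degree v.
Proof.
have /bigminn_geP[_ ec_le] := leqnn (edge_connectivity Gamma).
rewrite -card_star; apply: ec_le.
by rewrite isolating_cut powersetE star_sub_edges.
Qed.

End Degree.

Section UniversalVertex.

Variables (Gamma : sgraph) (u : Gamma).
Hypothesis adj_u : forall v, v != u -> adj u v.

Lemma degree_le_cut (F : {set {set Gamma}}) (s : Gamma) :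
  ~~ connect (@adj (del_edges F)) u s -> degree s <= #|F|.
Proof.
move=> nus; pose e : rel Gamma := @adj (del_edges F).
have sym_e : connect_sym e by exact: sym_connect_sym (del_adj_sym F).
pose S := [pred w : Gamma | connect e s w].
have nSu : u \notin S by rewrite inE sym_e.
(* An edge leaving [S] and not in [F] would survive the deletion and put [y] in the component
   [S]. *)
have cut (x y : Gamma) : x \in S -> y \notin S -> adj x y -> [set x; y] \in F.
  rewrite !inE => Sx nSy xy; apply: contraNT nSy => nF.
  by apply: connect_trans Sx (connect1 _); rewrite /e /= /del_adj xy.
pose f (w : Gamma) := if w \in S then [set w; u] else [set s; w].
have Ss : s \in S by rewrite inE connect0.
have neq_uS (w : Gamma) : w \in S -> w != u by apply: contraTneq => ->.
have f_inj : {in [set w | adj s w] &, injective f}.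
  have other (a b c : Gamma) : a != b -> [set a; b] = [set a; c] -> b = c.
    move=> ab E; have : b \in [set a; c] by rewrite -E set22.
    by rewrite !inE eq_sym (negPf ab) => /eqP.
  (* The two kinds of edges never coincide: [s] differs from its neighbour [w], and from [u], which
     is outside [S]. *)
  have mixed (w w' : Gamma) : adj s w -> w \in S -> [set w; u] <> [set s; w'].
    move=> sw Sw E; have : s \in [set w; u] by rewrite E set21.
    rewrite !inE (negPf (neq_uS s Ss)) orbF => /eqP Esw.
    by rewrite Esw adj_irrefl in sw.
  move=> w w'; rewrite !inE /f => sw sw'.
  case: ifPn => Sw; case: ifPn => Sw'.
  - by rewrite ![[set _; u]]setUC; apply: other; rewrite eq_sym neq_uS.
  - by move/mixed; case.
  - by move/esym/mixed; case.
  - by apply: other; apply: contraNneq Sw => <-.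
rewrite /degree -(card_in_imset f_inj) subset_leq_card //.
apply/subsetP => _ /imsetP[w sw ->]; rewrite inE in sw.
rewrite /f; case: ifPn => Sw; last exact: cut.
(* Universality of [u] makes [[set w; u]] an edge of the graph. *)
by apply: cut; rewrite // adj_sym adj_u ?neq_uS.
Qed.

Lemma min_degree_le_cut (F : {set {set Gamma}}) :
  disconnected_or_trivial (del_edges F) -> min_degree Gamma <= #|F|.
Proof.
case/orP=> [|/eqP Gamma1].
  have sym_e : connect_sym (@adj (del_edges F)).
    exact: sym_connect_sym (del_adj_sym F).
  rewrite negb_forall => /existsP[x]; rewrite negb_forall => /existsP[y nxy].
  (* Not both [x] and [y] can be connected to [u], so one of them serves as the separated vertex. *)
  have [ux|nux] := boolP (connect (@adj (del_edges F)) u x).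
    apply: leq_trans (min_degree_le Gamma y) (degree_le_cut _ _ _).
    by apply: contra nxy => uy; rewrite (connect_trans _ uy) // sym_e.
  exact: leq_trans (min_degree_le Gamma x) (degree_le_cut _ _ nux).
(* In a one-vertex graph [u] has degree 0. *)
apply: leq_trans (min_degree_le Gamma u) _; rewrite /degree.
rewrite (_ : [set w | adj u w] = set0) ?cards0 //.
apply/setP => w; rewrite !inE.
by rewrite (fintype_le1P _ w u) ?adj_irrefl // Gamma1.
Qed.

Lemma edge_connectivity_universal : edge_connectivity Gamma = min_degree Gamma.
Proof.
(* The first and third goals concern the defaults [#|Gamma|] and [#|edges Gamma|]; both are at least
   [degree u]. *)
apply/eqP; rewrite eqn_leq; apply/andP; split; apply/bigminn_geP; split.
- exact: leq_trans (edge_connectivity_le_degree _ u) (max_card _).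
- by move=> v _; apply: edge_connectivity_le_degree.
- apply: leq_trans (min_degree_le Gamma u) _.
  by rewrite -card_star subset_leq_card ?star_sub_edges.
- by move=> F /andP[_]; apply: min_degree_le_cut.
Qed.

End UniversalVertex.

Theorem theorem3p2 (gT : finGroupType) :
  edge_connectivity (power_graph gT) = min_degree (power_graph gT).
Proof.
apply: (@edge_connectivity_universal (power_graph gT) 1%g) => v nv1.
apply/asboolP; split; first by move=> E; rewrite -E eqxx in nv1.
by right; exists 0; rewrite expg0.
Qed.
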